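(* Let $Q$ be a medial quandle. Then $Q$ is involutory if and only if all orbits of $Q$ (as subquandles) are dihedral quandles (cores of abelian groups).
   Context: A quandle is a non-empty set $Q$ with a binary operation such that for all $x,y,z$: $xx=x$; $x(yz)=(xy)(xz)$; and $xu=y$ has a unique solution $u\in Q$. It is medial if $(xy)(uv)=(xu)(yv)$ for all $x,y,u,v\in Q$, and involutory if $x(xy)=y$ for all $x,y\in Q$. The left translation by $a$ is $L_a(x)=ax$; $\mathrm{LMlt}(Q)$ is the permutation group generated by all $L_a$, $a\in Q$. The orbits of $Q$ are the orbits of the action of $\mathrm{LMlt}(Q)$ on $Q$; each orbit is a subquandle of $Q$. A dihedral quandle (core of an abelian group) is an affine quandle of the form $\mathrm{Aff}(A,-1)$ with $A$ an abelian group, i.e., the set $A$ with the operation $a*b=2a-b$.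
   Formalization: ''Is a dihedral quandle'' is read as: the orbit is Aff(A,-1) with A the orbit group at each base point (addition induced by the displacement group); with an arbitrary abelian group A the ''if'' direction fails, e.g. for Z/4 plus a point acting by x+1. *)

(* Defs.v *)
From mathcomp Require Import all_boot all_algebra.

Set Implicit Arguments.
Unset Strict Implicit.
Unset Printing Implicit Defensive.

Import GRing.Theory.
Local Open Scope ring_scope.

Section Quandles.

Variables (Q : Type) (op : Q -> Q -> Q).

Record quandle : Prop := Quandle {
  quandle_nonempty : exists x : Q, True;
  quandle_idem : forall x, op x x = x;
  quandle_distr : forall x y z, op x (op y z) = op (op x y) (op x z);
  quandle_div : forall x y, exists! u, op x u = y
}.

Definition medial : Prop :=
  forall x y u v, op (op x y) (op u v) = op (op x u) (op y v).

Definition involutory : Prop := forall x y, op x (op x y) = y.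

(* The subgroup of the symmetric group of Q generated by S; this is meant for
   sets S of bijections, as [gen_inv] only adds two-sided inverses. *)
Inductive perm_generated (S : (Q -> Q) -> Prop) : (Q -> Q) -> Prop :=
| gen_in g of S g : perm_generated S g
| gen_id : perm_generated S id
| gen_comp g h of perm_generated S g & perm_generated S h :
    perm_generated S (g \o h)
| gen_inv g h of perm_generated S g & cancel g h & cancel h g :
    perm_generated S h.

Definition LMlt : (Q -> Q) -> Prop :=
  perm_generated (fun g => exists a, g = op a).

(* The displacement group, generated by all L_a L_b^-1. *)
Definition Dis : (Q -> Q) -> Prop :=
  perm_generated (fun g => exists a b Lbinv,
    [/\ cancel (op b) Lbinv, cancel Lbinv (op b) & g = op a \o Lbinv]).

Definition qorbit (e x : Q) : Prop := exists2 g, LMlt g & g e = x.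

(* [i] identifies the abelian group [A] with the orbit group at [e], that is,
   the orbit of [e] with neutral element [e] and with the addition
   alpha(e) + beta(e) := alpha(beta(e)) for alpha, beta in Dis(Q). In a medial
   quandle Dis(Q) is abelian and has the same orbits as LMlt(Q), so that this
   addition is well defined and total on the orbit. *)
Record is_orbit_group (e : Q) (A : zmodType) (i : A -> Q) : Prop := OrbitGroup {
  orbit_group_inj : injective i;
  orbit_group_range : forall x, qorbit e x <-> exists a, i a = x;
  orbit_group_zero : i 0 = e;
  orbit_group_add : forall alpha beta a b, Dis alpha -> Dis beta ->
    i a = alpha e -> i b = beta e -> i (a + b) = alpha (beta e)
}.

(* The orbit of [e], as a subquandle, is Aff(A, -1), where A is the orbit
   group at [e]. An isomorphism with Aff(A, -1) for an unrelated abelian group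
   A would not do: on the disjoint union of Z/4 and a point p, let L_p be
   x |-> x + 1 on Z/4 and fix p, and let the other left translations be
   trivial. This medial quandle is not involutory, yet its orbit Z/4 is a
   projection quandle, hence isomorphic to Aff((Z/2)^2, -1). Over the orbit
   group Z/4 this orbit is Aff(Z/4, 1), which is not Aff(Z/4, -1). *)
Definition dihedral_orbit (e : Q) : Prop :=
  exists (A : zmodType) (i : A -> Q),
    is_orbit_group e i /\ (forall a b, i (a *+ 2 - b) = op (i a) (i b)).

End Quandles.

(* Main.v *)
Require Import Defs.
From mathcomp Require Import all_boot all_algebra.
From HB Require Import structures.
From mathcomp Require Import boolp.

(** Write [L_a] for [op a].  Mediality together with left distributivity says
    exactly that [L_a L_b^-1 L_c = L_c L_b^-1 L_a] for all [a], [b], [c]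
    ([medial_translations]).  Hence [Dis] is abelian ([Dis_comm]), and the orbit
    of a point under an abelian group of bijections is itself an abelian group,
    on which the acting group is the group of translations
    ([abelian_orbit_group]).  As [L_e] fixes [e], [Dis] has the same orbits as
    [LMlt] ([qorbit_Dis]), so the orbit of every point carries its orbit group.

    If the quandle is involutory, the same identity with [L_b^-1 = L_b] says
    that conjugation by [L_e] inverts [Dis] ([Dis_inverted]).  So [L_e] maps
    [delta e] to [delta^-1 e]: it is negation on the orbit group at [e].  The
    elements of [Dis] are automorphisms, and moving the base point from [e] to
    [alpha e] gives
      [L_(alpha e) (beta e) = alpha L_e alpha^-1 beta e
                            = alpha beta^-1 alpha e],
    which is [2a - b] in the orbit group.

    Conversely, [x (x y) = y] has to be derived also when [x] is outside the
    orbit of [y], where the operation of that orbit is silent about [L_x].  But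
    [L_x = delta L_y] with [delta := L_x L_y^-1] in [Dis], where [L_y] is
    negation on the orbit group at [y] and [delta] is the translation by
    [a := x y].  So [L_x] is the map [c |-> a - c] on that orbit, which sends
    [0] to [a] and [a] back to [0]. *)

Set Implicit Arguments.
Unset Strict Implicit.
Unset Printing Implicit Defensive.

Import GRing.Theory.
Local Open Scope ring_scope.

(** * Orbits of abelian permutation groups *)

Section GeneratedPermutations.

Variables (T : Type) (S : (T -> T) -> Prop).
Hypothesis S_bij : forall g, S g -> bijective g.

Lemma perm_generated_inv g : perm_generated S g ->
  exists h, [/\ perm_generated S h, cancel g h & cancel h g].
Proof.
elim=> {g} [g Sg||g h _ [g' [Gg' gK g'K]] _ [h' [Gh' hK h'K]]
           |g h Gg _ gK hK]; last by exists g.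
- have [h gK hK] := S_bij Sg.
  by exists h; split=> //; exact: gen_inv (gen_in Sg) gK hK.
- by exists id; split=> //; exact: gen_id.
- exists (h' \o g'); split; first exact: gen_comp.
  + exact: can_comp gK hK.
  + exact: can_comp h'K g'K.
Qed.

Lemma perm_generated_comml (f : T -> T) :
    (forall g, S g -> forall x, f (g x) = g (f x)) ->
  forall g, perm_generated S g -> forall x, f (g x) = g (f x).
Proof.
move=> fS g; elim=> {g} [//|//|g h _ IHg _ IHh x|g h _ IHg gK hK x] /=.
- by rewrite IHg IHh.
- by rewrite -[LHS]gK -IHg hK.
Qed.

Hypothesis S_comm :
  forall g h, S g -> S h -> forall x, g (h x) = h (g x).

Lemma perm_generated_comm g h : perm_generated S g -> perm_generated S h ->
  forall x, g (h x) = h (g x).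
Proof.
move=> Gg; apply: perm_generated_comml => k Sk x.
by symmetry; apply: (perm_generated_comml _ Gg) => l Sl y; exact: S_comm Sk Sl y.
Qed.

(** Two elements of an abelian permutation group which agree at [e] agree on
    the whole orbit of [e]; so [alpha (beta e)] depends only on the points
    [alpha e] and [beta e], and the addition may be computed with an arbitrary
    choice of [rep] sending [e] to a given point. *)
Lemma abelian_orbit_group (e : T) : exists (A : zmodType) (i : A -> T),
  [/\ injective i,
      forall x, (exists2 g, perm_generated S g & g e = x)
                  <-> exists a, i a = x,
      i 0 = e
    & forall alpha beta a b, perm_generated S alpha -> perm_generated S beta ->
        i a = alpha e -> i b = beta e -> i (a + b) = alpha (beta e)].
Proof.
pose orb x := exists2 g, perm_generated S g & g e = x.
pose A := {classic {x | orb x}}; pose pt (a : A) : T := sval a.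
have pt_inj : injective pt by move=> [x p] [y q] xy; exact: eq_exist.
have /choice[rep repP] : forall a : A, exists g,
  perm_generated S g /\ g e = pt a by case=> x ox; case: (ox) => g Gg ge; exists g.
have /choice[neg negP] : forall a : A, exists b : A, rep a (pt b) = e.
  move=> a; have [h [Gh _ hK]] := perm_generated_inv (repP a).1.
  by exists (exist _ (h e) (ex_intro2 _ _ h Gh erefl)); exact: hK.
have /choice[add2 addP] : forall ab : A * A, exists c : A,
    pt c = rep ab.1 (pt ab.2).
  move=> [a b] /=; have [Ga _] := repP a; have [Gb eb] := repP b.
  have oab : orb (rep a (pt b)).
    by exists (rep a \o rep b); [exact: gen_comp | rewrite /= eb].
  by exists (exist _ _ oab).
pose add a b := add2 (a, b).
pose zero : A := exist _ e (ex_intro2 _ _ id (gen_id S) erefl).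
have ptD a b : pt (add a b) = rep a (pt b) by rewrite addP.
have ptDE alpha beta a b : perm_generated S alpha -> perm_generated S beta ->
    pt a = alpha e -> pt b = beta e -> pt (add a b) = alpha (beta e).
  move=> Galpha Gbeta ea eb; have [Ga ra] := repP a.
  rewrite ptD eb (perm_generated_comm Ga Gbeta) ra ea.
  exact: (perm_generated_comm Gbeta Galpha).
have addC : commutative add.
  move=> a b; apply: pt_inj; have [Ga ea] := repP a; have [Gb eb] := repP b.
  by rewrite !ptD -ea -eb; exact: (perm_generated_comm Ga Gb).
have addA : associative add.
  move=> a b c; apply: pt_inj; have [Ga ea] := repP a; have [Gb eb] := repP b.
  have [Gc ec] := repP c; rewrite [LHS]ptD ptD -ec.
  rewrite (@ptDE (rep a \o rep b) (rep c)) //; first exact: gen_comp.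
  by rewrite ptD -eb.
have add0 : left_id zero add.
  move=> a; apply: pt_inj; have [Ga ea] := repP a.
  by rewrite (@ptDE id (rep a)) //; exact: gen_id.
have addN : left_inverse zero neg add.
  by move=> a; rewrite addC; apply: pt_inj; rewrite ptD negP.
pose A_zmod := GRing.isZmodule.Build A addA addC add0 addN.
exists (HB.pack_for zmodType A A_zmod), pt; split=> // x; split.
- by move=> ox; exists (exist _ x ox).
- by case=> -[y oy] <-.
Qed.

End GeneratedPermutations.

(** * The displacement group of a medial quandle *)

Section MedialQuandles.

Variables (Q : Type) (op : Q -> Q -> Q).
Hypotheses (hQ : quandle op) (hmed : medial op).

Lemma left_division a : exists2 u, cancel (op a) u & cancel u (op a).
Proof.
have /choice[u uP] : forall y, exists u, op a u = y.
  by move=> y; have [u [uy _]] := quandle_div hQ a y; exists u.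
exists u => // x; have [v [_ vU]] := quandle_div hQ a (op a x).
by transitivity v; [symmetry|]; apply: vU.
Qed.

Lemma translation_inj a : injective (op a).
Proof. by have [u opK _] := left_division a; exact: can_inj opK. Qed.

(** After multiplying by [b] on the left and distributing, this is mediality:
    [(b a) (c z) = (b c) (a z)]. *)
Lemma medial_translations a b c u z : cancel u (op b) ->
  op a (u (op c z)) = op c (u (op a z)).
Proof.
move=> uK; apply: (@translation_inj b).
by rewrite !(quandle_distr hQ b) !uK hmed.
Qed.

Let Dis_gen (g : Q -> Q) := exists a b u,
  [/\ cancel (op b) u, cancel u (op b) & g = op a \o u].

Lemma Dis_gen_bij g : Dis_gen g -> bijective g.
Proof.
case=> a [b [u [opK uK ->]]]; have [v aK vK] := left_division a.
by exists (op b \o v); [exact: can_comp aK uK | exact: can_comp opK vK].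
Qed.

Lemma Dis_gen_comm g h : Dis_gen g -> Dis_gen h ->
  forall x, g (h x) = h (g x).
Proof.
case=> a [c [u [cK uK ->]]] [b [d [v [dK vK ->]]]] x /=.
(* The medial identity swaps [a] and [b]; it also holds for the inverses,
   in the form [u L_a v = v L_a u], which swaps [u] and [v]. *)
rewrite (medial_translations a b _ uK); congr op.
have -> : op a (v x) = op c (v (op a (u x))).
  by rewrite (medial_translations c a _ vK) uK.
exact: cK.
Qed.

Lemma Dis_inv d : Dis op d ->
  exists d', [/\ Dis op d', cancel d d' & cancel d' d].
Proof. exact: perm_generated_inv Dis_gen_bij d. Qed.

Lemma Dis_comm c d : Dis op c -> Dis op d -> forall x, c (d x) = d (c x).
Proof. exact: perm_generated_comm Dis_gen_comm c d. Qed.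

Lemma Dis_translation a b u : cancel (op b) u -> cancel u (op b) ->
  Dis op (op a \o u).
Proof. by move=> opK uK; apply: gen_in; exists a, b, u. Qed.

Lemma Dis_morph d : Dis op d -> {morph d : x y / op x y}.
Proof.
elim=> {d} [_ [a [b [u [opK uK ->]]]] x y||c d _ IHc _ IHd x y
           |c d _ IHc cK dK x y] //=.
- rewrite -(quandle_distr hQ); congr op; apply: (@translation_inj b).
  by rewrite (quandle_distr hQ) !uK.
- by rewrite IHd IHc.
- by rewrite -[RHS]cK IHc !dK.
Qed.

Lemma Dis_sub_LMlt d : Dis op d -> LMlt op d.
Proof.
elim=> {d} [_ [a [b [u [opK uK ->]]]]||c d _ IHc _ IHd|c d _ IHc cK dK].
- apply: gen_comp; first by apply: gen_in; exists a.
  by apply: (gen_inv _ opK uK); apply: gen_in; exists b.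
- exact: gen_id.
- exact: gen_comp.
- exact: gen_inv IHc cK dK.
Qed.

(** The displacement depends on the point [e]: at [e], the translation [L_a]
    agrees with [L_a L_e^-1] because [L_e] fixes [e]. *)
Lemma LMlt_eq_Dis_at g : LMlt op g ->
  forall e, exists2 d, Dis op d & d e = g e.
Proof.
elim=> {g} [_ [a ->] e|e|g h _ IHg _ IHh e|g h _ IHg gK hK e].
- have [u opK uK] := left_division e.
  exists (op a \o u); first exact: (Dis_translation a opK uK).
  by rewrite /= -{1}(quandle_idem hQ e) opK.
- by exists id => //; exact: gen_id.
- have [c Dc ce] := IHg (h e); have [d Dd de] := IHh e.
  by exists (c \o d); [exact: gen_comp | rewrite /= de].
- have [d Dd de] := IHg (h e); have [d' [Dd' dK _]] := Dis_inv Dd.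
  by exists d' => //; rewrite -{1}(hK e) -de dK.
Qed.

Lemma qorbit_Dis e x : qorbit op e x <-> exists2 d, Dis op d & d e = x.
Proof.
split=> -[g Gg <-]; first exact: LMlt_eq_Dis_at.
by exists g => //; exact: Dis_sub_LMlt.
Qed.

(** * Orbit groups *)

Lemma orbit_group_exists e : exists (A : zmodType) (i : A -> Q),
  is_orbit_group op e i.
Proof.
have [A [i [i_inj iP i0 iD]]] := abelian_orbit_group Dis_gen_bij Dis_gen_comm e.
exists A, i; split=> // x.
exact: iff_trans (qorbit_Dis e x) (iP x).
Qed.

Lemma orbit_group_rep e (A : zmodType) (i : A -> Q) (a : A) :
  is_orbit_group op e i -> exists2 d, Dis op d & i a = d e.
Proof.
case=> _ iP _ _; have /qorbit_Dis[d Dd <-] : qorbit op e (i a).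
  by apply/iP; exists a.
by exists d.
Qed.

Lemma orbit_group_opp e (A : zmodType) (i : A -> Q) (a : A) d d' :
    is_orbit_group op e i -> Dis op d -> cancel d d' -> i a = d e ->
  i (- a) = d' e.
Proof.
move=> iG Dd dK ia; have [c Dc ic] := orbit_group_rep (- a) iG.
case: iG => _ _ i0 iD; rewrite ic -(dK (c e)).
by rewrite -(iD _ _ a (- a) Dd Dc) // subrr i0.
Qed.

(** * Involutory medial quandles *)

(** The identity [L_a L_b L_e L_a L_b = L_e] for involutory [Q] comes from
    reversing [L_a L_b L_e] to [L_e L_b L_a].  Stated as [d L_e d = L_e],
    without inverses, the property passes through products since [Dis] is
    abelian. *)
Lemma Dis_inverted d : involutory op -> Dis op d ->
  forall e z, d (op e (d z)) = op e z.
Proof.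
move=> inv; elim=> {d} [_ [a [b [u [opK uK ->]]]] e z||c d Dc IHc Dd IHd e z
                       |c d _ IHc cK dK e z] //=.
- have uE y : u y = op b y by rewrite -{1}(inv b y) opK.
  by rewrite !uE (medial_translations a e _ (inv b)) !inv.
- by rewrite (Dis_comm Dc Dd (op e _)) IHc IHd.
- by rewrite -[z in RHS]dK -(IHc e (d z)) dK cK.
Qed.

End MedialQuandles.

Theorem corollary7p4 (Q : Type) (op : Q -> Q -> Q)
    (hQ : quandle op) (hmed : medial op) :
  involutory op <-> (forall e : Q, dihedral_orbit op e).
Proof.
split=> [inv e | dih x y].
- have [A [i iG]] := orbit_group_exists hQ hmed e.
  exists A, i; split=> // a b.
  have [alpha Da ia] := orbit_group_rep hQ a iG.
  have [beta Db ib] := orbit_group_rep hQ b iG.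
  have [alpha' [Da' aK a'K]] := Dis_inv hQ Da.
  have [beta' [Db' bK b'K]] := Dis_inv hQ Db.
  have ->: op (i a) (i b) = alpha (beta' (alpha e)).
    rewrite ia ib -{1}(a'K (beta e)) -(Dis_morph hQ Da); congr alpha.
    have Dd : Dis op (alpha' \o beta) by exact: gen_comp.
    have := Dis_inverted hQ hmed inv Dd e e; rewrite /= (quandle_idem hQ).
    by move/(congr1 alpha); rewrite a'K => /(congr1 beta'); rewrite bK.
  have iNb := orbit_group_opp hQ iG Db bK ib.
  have iD := orbit_group_add iG.
  (* The order of the summands in which [i] gives [alpha (beta' (alpha e))]. *)
  rewrite mulr2n -addrA [a - b]addrC.
  rewrite (iD alpha (beta' \o alpha)) //; first exact: gen_comp.
  exact: (iD beta' alpha).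
- have [A [i [iG iop]]] := dih y; have i0 := orbit_group_zero iG.
  have [u opK uK] := left_division hQ y.
  have Dd := Dis_translation x opK uK.
  have uy : u y = y by rewrite -{1}(quandle_idem hQ y) opK.
  have /(orbit_group_range iG)[a ia] : qorbit op y (op x y).
    by exists (op x) => //; apply: gen_in; exists x.
  have Lya : op y (i a) = i (- a) by rewrite -{1}i0 -iop mul0rn sub0r.
  have [beta Db ib] := orbit_group_rep hQ (- a) iG.
  (* Write the outer [op x] as [(op x \o u) \o op y]. *)
  rewrite -ia -(opK (i a)) Lya ib.
  rewrite -[LHS](orbit_group_add iG (a := a) (b := - a) Dd Db) ?subrr //.
  by rewrite ia /= uy.
Qed.
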